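(* Let $k,p$ be positive real numbers and $x\in\mathbb{C}\setminus k\mathbb{Z}^{-}$ with $\mathrm{Re}(x)>0$. Then $${}_{p}\Gamma_{k}(x)=\int_{0}^{\infty}e^{-\frac{t^{k}}{p}}\,t^{x-1}\,dt.$$
   Context: $\mathbb{Z}^-$ is the set of negative integers. The p-k Pochhammer symbol is ${}_{p}(x)_{n,k}=\left(\frac{xp}{k}\right)\left(\frac{xp}{k}+p\right)\cdots\left(\frac{xp}{k}+(n-1)p\right)$, and the p-k Gamma function is, for $\mathrm{Re}(x)>0$, $${}_{p}\Gamma_{k}(x)=\frac1k\lim_{n\to\infty}\frac{n!\,p^{n+1}(np)^{x/k}}{{}_{p}(x)_{n+1,k}}=\frac1k\lim_{n\to\infty}\frac{n!\,p^{n+1}(np)^{\frac{x}{k}-1}}{{}_{p}(x)_{n,k}}.$$ *)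

(* Defs.v *)
(* Stdlib reals with Coquelicot. *)
From Stdlib Require Import Reals Arith Lra Lia.
From Coquelicot Require Import Coquelicot.

Open Scope R_scope.

Definition Cexp (z : C) : C :=
  (exp (Re z) * cos (Im z), exp (Re z) * sin (Im z)).

(* Principal value of a^z; meaningful for a real base a > 0 only, because
   Stdlib sets ln a = 0 for a <= 0. *)
Definition RCpower (a : R) (z : C) : C := Cexp (z * RtoC (ln a))%C.

(* Total: the limit when the sequence converges in C, unspecified otherwise. *)
Definition Clim_seq (u : nat -> C) : C :=
  iota (T := C_R_CompleteNormedModule)
    (fun l : C => filterlim u eventually (locally l)).

Definition ex_Clim_seq (u : nat -> C) : Prop :=
  exists l : C, filterlim u eventually (locally l).

Fixpoint pk_pochhammer (p k : R) (x : C) (n : nat) : C :=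
  match n with
  | O => RtoC 1
  | S m => (pk_pochhammer p k x m *
            (x * RtoC p / RtoC k + RtoC (INR m * p)))%C
  end.

(* The value at n = 0 involves 0^(x/k) and is irrelevant to the limit. *)
Definition pkGamma_seq (p k : R) (x : C) (n : nat) : C :=
  (RtoC (INR (fact n)) * RtoC (p ^ (n + 1)) *
   RCpower (INR n * p) (x / RtoC k) /
   pk_pochhammer p k x (n + 1))%C.

(* To be used for 0 < Re x. *)
Definition pkGamma (p k : R) (x : C) : C :=
  (RtoC (1 / k) * Clim_seq (pkGamma_seq p k x))%C.

Definition pkGamma_seq' (p k : R) (x : C) (n : nat) : C :=
  (RtoC (INR (fact n)) * RtoC (p ^ (n + 1)) *
   RCpower (INR n * p) (x / RtoC k - RtoC 1) /
   pk_pochhammer p k x n)%C.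

Lemma filterlim_Clim_seq (u : nat -> C) :
  ex_Clim_seq u -> filterlim u eventually (locally (Clim_seq u)).
Proof.
intros [l Hl].
apply (iota_correct (V := C_R_CompleteNormedModule)
  (fun l : C => filterlim u eventually (locally l))).
exists l; split; [exact Hl|].
intros l' Hl'.
exact (filterlim_locally_unique (V := C_R_NormedModule) u l l' Hl Hl').
Qed.

Lemma Cexp_plus (z w : C) : Cexp (z + w) = (Cexp z * Cexp w)%C.
Proof.
destruct z as [a b], w as [c d]; unfold Cexp, Cmult, Cplus; simpl.
rewrite exp_plus, cos_plus, sin_plus; f_equal; ring.
Qed.

Lemma RCpower_minus1 (a : R) (z : C) :
  0 < a -> RCpower a z = (RCpower a (z - RtoC 1) * RtoC a)%C.
Proof.
intros Ha; unfold RCpower.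
replace (z * RtoC (ln a))%C
  with ((z - RtoC 1) * RtoC (ln a) + RtoC (ln a))%C by ring.
rewrite Cexp_plus; f_equal.
unfold Cexp, RtoC; simpl.
now rewrite exp_ln, cos_0, sin_0, Rmult_1_r, Rmult_0_r.
Qed.

Lemma pkGamma_seq_ratio (p k : R) (x : C) (n : nat) :
  0 < p -> 0 < k -> 0 < Re x -> (0 < n)%nat ->
  pkGamma_seq' p k x n =
  (pkGamma_seq p k x n * (RtoC 1 + x / RtoC k * RtoC (/ INR n)))%C.
Proof.
intros Hp Hk Hx Hn.
assert (Hn0 : 0 < INR n) by now apply lt_0_INR.
assert (Hf : forall m, (x * RtoC p / RtoC k + RtoC (INR m * p))%C <> RtoC 0).
{ intros m H; apply (f_equal Re) in H.
  assert (E : (x * RtoC p / RtoC k + RtoC (INR m * p))%C =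
              (x * RtoC (p / k) + RtoC (INR m * p))%C).
  { rewrite RtoC_div by lra; field; intros E; apply RtoC_inj in E; lra. }
  rewrite E, re_plus, re_scal_r in H; simpl in H.
  assert (0 < p / k) by now apply Rdiv_lt_0_compat.
  assert (0 <= INR m * p) by (apply Rmult_le_pos; [apply pos_INR | lra]).
  assert (0 < fst x * (p / k)) by now apply Rmult_lt_0_compat.
  unfold Re in H; lra. }
assert (Hpoch : forall m, pk_pochhammer p k x m <> RtoC 0).
{ induction m as [|m IH]; simpl; [apply C1_nz | now apply Cmult_neq_0]. }
unfold pkGamma_seq, pkGamma_seq'.
rewrite (RCpower_minus1 (INR n * p) (x / RtoC k)) by now apply Rmult_lt_0_compat.
replace (pk_pochhammer p k x (n + 1)) with (pk_pochhammer p k x (S n))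
  by (f_equal; lia).
cbn [pk_pochhammer].
assert (Hk' : RtoC k <> RtoC 0) by (intros E; apply RtoC_inj in E; lra).
assert (Hp' : RtoC p <> RtoC 0) by (intros E; apply RtoC_inj in E; lra).
assert (Hn' : RtoC (INR n) <> RtoC 0) by (intros E; apply RtoC_inj in E; lra).
specialize (Hf n); specialize (Hpoch n).
rewrite RtoC_inv by lra; rewrite RtoC_mult in *.
field; repeat split; auto.
intros E; apply Hf.
replace (x * RtoC p / RtoC k + RtoC (INR n) * RtoC p)%C
  with ((x * RtoC p + RtoC (INR n) * RtoC p * RtoC k) / RtoC k)%C
  by (field; auto).
replace (x * RtoC p + RtoC (INR n) * RtoC p * RtoC k)%C with (RtoC 0).
now field.
Qed.

Lemma filterlim_Cmult (x y : C) :
  filterlim (fun z : C * C => (fst z * snd z)%C)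
    (filter_prod (locally x) (locally y)) (locally (x * y)%C).
Proof.
intros P HP; apply locally_C in HP.
destruct (filterlim_mult (K := C_AbsRing) x y P HP) as [Q R HQ HR H].
exists Q R; [now apply locally_C | now apply locally_C | exact H].
Qed.

(* The two limits that define the p-k Gamma function agree. *)
Lemma pkGamma_seq'_lim (p k : R) (x l : C) :
  0 < p -> 0 < k -> 0 < Re x ->
  filterlim (pkGamma_seq p k x) eventually (locally l) ->
  filterlim (pkGamma_seq' p k x) eventually (locally l).
Proof.
intros Hp Hk Hx Hl.
apply filterlim_ext_loc with
  (fun n => pkGamma_seq p k x n * (RtoC 1 + x / RtoC k * RtoC (/ INR n)))%C.
{ exists 1%nat; intros n Hn; symmetry.
  apply pkGamma_seq_ratio; auto; lia. }
assert (Hinv : filterlim (fun n => RtoC (/ INR n)) eventually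
                 (locally (RtoC 0))).
{ assert (H : is_lim_seq (fun n => / INR n) 0).
  { replace (Finite 0) with (Rbar_inv p_infty) by reflexivity.
    apply is_lim_seq_inv; [apply is_lim_seq_INR | discriminate]. }
  apply filterlim_locally; intros eps.
  generalize (proj1 (filterlim_locally _ _) H eps).
  apply filter_imp; intros n Hn; split; [exact Hn | apply ball_center]. }
assert (Hlim : forall (u v : nat -> C) (a b : C),
  filterlim u eventually (locally a) -> filterlim v eventually (locally b) ->
  filterlim (fun n => (u n * v n)%C) eventually (locally (a * b)%C)).
{ intros u v a b Hu Hv.
  exact (filterlim_comp_2 u v Cmult Hu Hv (filterlim_Cmult a b)). }
replace l with (l * (RtoC 1 + x / RtoC k * RtoC 0))%C by ring.
apply Hlim; [exact Hl|].
refine (filterlim_comp_2 (fun _ => RtoC 1) _ Cplus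
  (filterlim_const (RtoC 1)) _
  (filterlim_plus (V := C_R_NormedModule) _ _)).
apply Hlim; [apply filterlim_const | exact Hinv].
Qed.

(* Main.v *)
(* Put s = t^k / p.  The function (1 - s/n)^n t^(x-1) has an explicit primitive on
   (0, oo), found by integrating by parts n times; it vanishes at 0, and at the
   point T with T^k = n p it equals the n-th term of the sequence defining the p-k
   Gamma function, divided by k.  The estimate
   |e^(-s) - (1 - s/n)^n| <= s^2 e^(-s) / n on [0, n] shows that replacing
   (1 - s/n)^n by e^(-s) in the integral over (0, T] costs O(1/n), so the sequence
   converges to k times the improper integral. *)
Require Import Defs.
From Stdlib Require Import Reals Arith Lra Lia.
From Coquelicot Require Import Coquelicot.
Open Scope R_scope.

(** * Derivatives and continuity of complex-valued functions of a real variable *)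

Lemma is_derive_C_pair (u v : R -> R) (t du dv : R) :
  is_derive u t du -> is_derive v t dv ->
  is_derive (V := C_R_NormedModule) (fun s => (u s, v s)) t (du, dv).
Proof.
intros Hu Hv.
assert (E : forall a b : R,
  @plus C_R_NormedModule (@scal _ C_R_NormedModule a (RtoC 1))
    (@scal _ C_R_NormedModule b Ci) = (a, b)).
{ intros a b; rewrite !scal_R_Cmult; apply injective_projections; simpl;
    unfold plus, scal, mult; simpl; ring. }
rewrite <- E.
apply (is_derive_ext (V := C_R_NormedModule)
  (fun s => @plus C_R_NormedModule (@scal _ C_R_NormedModule (u s) (RtoC 1))
    (@scal _ C_R_NormedModule (v s) Ci))).
{ intros s; apply E. }
apply (is_derive_plus (V := C_R_NormedModule));
now apply (is_derive_scal_l (V := C_R_NormedModule)).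
Qed.

(** Differentiation is over the reals, so a non-real [c] is not a scalar of the module. The
    projections [fst] and [snd] are real-linear, which reduces the rule to real derivatives of the
    two coordinates. *)
Lemma is_derive_Cmult_l (c : C) (f : R -> C) (t : R) (l : C) :
  is_derive (V := C_R_NormedModule) f t l ->
  is_derive (V := C_R_NormedModule) (fun s => (c * f s)%C) t (c * l)%C.
Proof.
intros Hf.
assert (H1 : is_derive (fun s => Re (f s)) t (Re l)).
{ refine (filterdiff_comp' (U := R_NormedModule) (V := C_R_NormedModule)
    (W := R_NormedModule) f fst t (fun y => @scal _ C_R_NormedModule y l) fst Hf _).
  apply filterdiff_linear.
  exact (is_linear_fst (U := R_NormedModule) (V := R_NormedModule)). }
assert (H2 : is_derive (fun s => Im (f s)) t (Im l)).
{ refine (filterdiff_comp' (U := R_NormedModule) (V := C_R_NormedModule)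
    (W := R_NormedModule) f snd t (fun y => @scal _ C_R_NormedModule y l) snd Hf _).
  apply filterdiff_linear.
  exact (is_linear_snd (U := R_NormedModule) (V := R_NormedModule)). }
apply (is_derive_C_pair (fun s => fst c * fst (f s) - snd c * snd (f s))
  (fun s => fst c * snd (f s) + snd c * fst (f s))).
- apply (is_derive_minus (V := R_NormedModule)); now apply is_derive_scal.
- apply (is_derive_plus (V := R_NormedModule)); now apply is_derive_scal.
Qed.

Lemma is_derive_RtoC_mult (u : R -> R) (f : R -> C) (t du : R) (df : C) :
  is_derive u t du -> is_derive (V := C_R_NormedModule) f t df ->
  is_derive (V := C_R_NormedModule) (fun s => (RtoC (u s) * f s)%C) t
    (RtoC du * f t + RtoC (u t) * df)%C.
Proof.
intros Hu Hf.
apply (is_derive_ext (V := C_R_NormedModule) (fun s => @scal _ C_R_NormedModule (u s) (f s))).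
{ intros s; apply scal_R_Cmult. }
rewrite <- !scal_R_Cmult.
unfold is_derive.
eapply filterdiff_ext_lin.
{ apply (filterdiff_scal_fct (V := C_R_NormedModule) t u f);
    [exact Rmult_comm | exact Hu | exact Hf]. }
intros y; apply injective_projections; unfold scal, plus, mult; simpl;
  unfold scal, plus, mult; simpl; unfold mult; simpl; ring.
Qed.

Lemma is_derive_RCpower (z : C) (t : R) :
  0 < t ->
  is_derive (V := C_R_NormedModule) (fun s => RCpower s z) t
    (z * RCpower t (z - RtoC 1))%C.
Proof.
intros Ht.
destruct z as [a b].
assert (E : forall s, RCpower s (a, b) =
  (exp (a * ln s) * cos (b * ln s), exp (a * ln s) * sin (b * ln s))).
{ intros s; unfold RCpower, Cexp; simpl.
  now rewrite !Rmult_0_r, Rminus_0_r, Rplus_0_l. }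
apply (is_derive_ext (V := C_R_NormedModule) _ _ _ _ (fun s => eq_sym (E s))).
(* The power t^(z-1) enters only through t^(z-1) = t^z / t, so both coordinates of the derivative
   become elementary functions of [ln t]. *)
assert (P := RCpower_minus1 t (a, b) Ht).
rewrite E in P.
set (w := RCpower t ((a, b) - RtoC 1)%C) in *; clearbody w.
assert (t <> 0) by lra.
pose proof (f_equal fst P) as P1; pose proof (f_equal snd P) as P2; simpl in P1, P2.
rewrite Rmult_0_r, Rminus_0_r in P1; rewrite Rmult_0_r, Rplus_0_l in P2.
assert (E1 : fst w = exp (a * ln t) * cos (b * ln t) / t) by (rewrite P1; now field).
assert (E2 : snd w = exp (a * ln t) * sin (b * ln t) / t) by (rewrite P2; now field).
apply is_derive_C_pair; (auto_derive; [now repeat split|]);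
  rewrite E1, E2; simpl; now field.
Qed.

Lemma Cmod_RCpower (t : R) (z : C) : Cmod (RCpower t z) = Rpower t (Re z).
Proof.
unfold RCpower, Cexp, Cmod, Rpower; simpl.
set (e := exp _); set (y := fst z * 0 + _).
replace (_ + _) with (e * e * (Rsqr (sin y) + Rsqr (cos y))) by (unfold Rsqr; ring).
rewrite sin2_cos2, Rmult_1_r, sqrt_square by apply Rlt_le, exp_pos.
unfold e; f_equal; unfold Re; ring.
Qed.

Lemma continuous_RCpower (z : C) (t : R) :
  0 < t -> continuous (U := C_R_NormedModule) (fun s => RCpower s z) t.
Proof.
intros Ht; apply (ex_derive_continuous (V := C_R_NormedModule)).
eexists; now apply is_derive_RCpower.
Qed.

Lemma continuous_RtoC_mult (u : R -> R) (f : R -> C) (t : R) :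
  continuous u t -> continuous (U := C_R_NormedModule) f t ->
  continuous (U := C_R_NormedModule) (fun s => (RtoC (u s) * f s)%C) t.
Proof.
intros Hu Hf.
apply (continuous_ext (T := R_UniformSpace) (U := C_R_NormedModule)
  (fun s => @scal _ C_R_NormedModule (u s) (f s))).
{ intros s; apply scal_R_Cmult. }
now apply (continuous_scal (V := C_R_NormedModule)).
Qed.

(** * Real powers and exponential bounds *)

Lemma is_derive_Rpower (a t : R) :
  0 < t -> is_derive (fun s => Rpower s a) t (a * Rpower t (a - 1)).
Proof. intros Ht; now apply is_derive_Reals, derivable_pt_lim_power. Qed.

Lemma Rpower_minus1 (a t : R) : 0 < t -> Rpower t (a - 1) * t = Rpower t a.
Proof.
intros Ht; rewrite <- (Rpower_1 t) at 2 by assumption.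
rewrite <- Rpower_plus; f_equal; ring.
Qed.

Lemma C_norm (z : C) : @norm _ C_R_NormedModule z = Cmod z.
Proof. symmetry; exact (Cmod_norm z). Qed.

Lemma exp_le_compat (x y : R) : x <= y -> exp x <= exp y.
Proof.
intros [H| ->]; [now apply Rlt_le, exp_increasing | apply Rle_refl].
Qed.

(** With s = t^k and c = a/k, the logarithm of the product is c ln s - s/p, which is largest at s =
    c p. The inequality ln u <= u - 1 at u = s/(c p) bounds it by c ln(c p) - c, and -c is dropped.
    The case a = 0 is separate because c p must be positive. *)
Lemma Rpower_exp_bounded (a k p : R) :
  0 <= a -> 0 < k -> 0 < p ->
  exists M, 0 <= M /\
    forall t, 0 < t -> Rpower t a * exp (- (Rpower t k / p)) <= M.
Proof.
intros Ha Hk Hp.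
destruct (Req_dec a 0) as [->|Ha0].
{ exists 1; split; [lra|]; intros t Ht.
  rewrite Rpower_O, Rmult_1_l by assumption.
  rewrite <- exp_0; apply exp_le_compat.
  assert (0 < Rpower t k / p) by (apply Rdiv_lt_0_compat; [apply exp_pos|assumption]).
  lra. }
assert (Hc : 0 < a / k) by (apply Rdiv_lt_0_compat; lra).
set (c := a / k) in *.
assert (Hcp : 0 < c * p) by now apply Rmult_lt_0_compat.
exists (exp (c * ln (c * p))); split; [apply Rlt_le, exp_pos|]; intros t Ht.
unfold Rpower at 1; rewrite <- exp_plus; apply exp_le_compat.
set (s := Rpower t k).
assert (Hs : 0 < s) by apply exp_pos.
assert (Hl : ln s = k * ln t) by apply ln_exp.
assert (L : ln s - ln (c * p) <= s / (c * p) - 1).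
{ rewrite <- ln_div by assumption.
  assert (0 < s / (c * p)) by now apply Rdiv_lt_0_compat.
  pose proof (exp_ineq1_le (ln (s / (c * p)))) as H1.
  rewrite exp_ln in H1 by assumption; lra. }
apply (Rmult_le_compat_l c) in L; [|lra].
replace (c * (s / (c * p) - 1)) with (s / p - c) in L by (field; split; lra).
replace (a * ln t) with (c * ln s) by (rewrite Hl; unfold c; field; lra).
lra.
Qed.

(** Put y = s/n. The upper bound (1-y)^n <= e^(-s) is the n-th power of 1-y <= e^(-y). For the lower
    one, e^s >= (1+y)^n gives (1-y)^n e^s >= (1-y^2)^n, and Bernoulli's inequality gives (1-y^2)^n
    >= 1 - n y^2, where n y^2 = s^2/n. *)
Lemma exp_sub_pow_bound (n : nat) (s : R) :
  (0 < n)%nat -> 0 <= s <= INR n ->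
  Rabs (exp (- s) - (1 - s / INR n) ^ n) <= s ^ 2 * exp (- s) / INR n.
Proof.
intros Hn Hs.
assert (HN : 0 < INR n) by now apply lt_0_INR.
set (y := s / INR n).
assert (Hy : 0 <= y <= 1).
{ unfold y; split; [apply Rdiv_le_0_compat; lra|].
  apply (Rmult_le_reg_r (INR n)); [assumption|].
  replace (s / INR n * INR n) with s by (field; lra); lra. }
assert (En : forall u, exp (INR n * u) = exp u ^ n).
{ intros u; clear; induction n as [|n IH]; [now rewrite Rmult_0_l, exp_0|].
  rewrite S_INR, <- tech_pow_Rmult, <- IH, <- exp_plus; f_equal; ring. }
assert (Es : s = INR n * y) by (unfold y; field; lra).
assert (U : (1 - y) ^ n <= exp (- s)).
{ replace (- s) with (INR n * - y) by (rewrite Es; ring).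
  rewrite En; apply pow_incr; pose proof (exp_ineq1_le (- y)); lra. }
assert (L : (1 - INR n * y ^ 2) * exp (- s) <= (1 - y) ^ n).
{ apply Rle_trans with ((1 - y ^ 2) ^ n * exp (- s)).
  - apply Rmult_le_compat_r; [apply Rlt_le, exp_pos|].
    assert (B : forall u m, 0 <= u <= 1 -> 1 - INR m * u <= (1 - u) ^ m).
    { clear; intros u m Hu; induction m as [|m IH]; [simpl; lra|].
      rewrite S_INR; simpl.
      apply (Rmult_le_compat_l (1 - u)) in IH; [|lra].
      pose proof (pos_INR m); nra. }
    apply B; nra.
  - replace (1 - y ^ 2) with ((1 - y) * (1 + y)) by ring.
    rewrite Rpow_mult_distr, Rmult_assoc.
    rewrite <- (Rmult_1_r ((1 - y) ^ n)) at 2.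
    apply Rmult_le_compat_l; [apply pow_le; lra|].
    replace 1 with (exp s * exp (- s)) at 2
      by (rewrite <- exp_plus, Rplus_opp_r; apply exp_0).
    apply Rmult_le_compat_r; [apply Rlt_le, exp_pos|].
    rewrite Es, En; apply pow_incr; pose proof (exp_ineq1_le y); lra. }
replace (s ^ 2 * exp (- s) / INR n) with (INR n * y ^ 2 * exp (- s))
  by (unfold y; field; lra).
rewrite Rabs_pos_eq; lra.
Qed.

(** * Domination by an explicit integrable weight *)

(* Up to a constant, t^(r-1) / (1 + t^r)^2 dominates every integrand met below, and
   it has an elementary primitive, bounded on (0, oo). *)
Definition tame_weight (r t : R) : R := Rpower t (r - 1) / (1 + Rpower t r) ^ 2.

Definition tame_primitive (r t : R) : R := - / (r * (1 + Rpower t r)).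

Lemma is_derive_tame_primitive (r t : R) :
  0 < r -> 0 < t -> is_derive (tame_primitive r) t (tame_weight r t).
Proof.
intros Hr Ht; unfold tame_primitive, tame_weight.
assert (0 < Rpower t r) by apply exp_pos.
replace (Rpower t (r - 1) / (1 + Rpower t r) ^ 2) with
  (- (- (r * (0 + r * Rpower t (r - 1))) / (r * (1 + Rpower t r)) ^ 2))
  by (field; split; lra).
apply (is_derive_opp (V := R_NormedModule)).
apply (is_derive_inv (fun s => r * (1 + Rpower s r))).
- apply is_derive_scal, (is_derive_plus (V := R_NormedModule)).
  + apply (is_derive_const (V := R_NormedModule)).
  + now apply is_derive_Rpower.
- apply Rgt_not_eq, Rmult_lt_0_compat; lra.
Qed.

Lemma continuous_Rpower (a t : R) : 0 < t -> continuous (fun s => Rpower s a) t.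
Proof.
intros Ht; apply (ex_derive_continuous (V := R_NormedModule)).
eexists; now apply is_derive_Rpower.
Qed.

Lemma is_RInt_tame_weight (r a b : R) :
  0 < r -> 0 < a <= b ->
  is_RInt (tame_weight r) a b (tame_primitive r b - tame_primitive r a).
Proof.
intros Hr Hab.
apply (is_RInt_derive (V := R_CompleteNormedModule)).
- intros t; rewrite Rmin_left by lra; intros Ht.
  apply is_derive_tame_primitive; lra.
- intros t; rewrite Rmin_left by lra; intros Ht.
  unfold tame_weight, Rdiv.
  assert (0 < Rpower t r) by apply exp_pos.
  apply (continuous_mult (K := R_AbsRing)); [apply continuous_Rpower; lra|].
  apply (continuous_comp (fun s => Rpower s r) (fun y => / (1 + y) ^ 2)).
  + apply continuous_Rpower; lra.
  + apply (ex_derive_continuous (V := R_NormedModule)).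
    auto_derive; repeat split; nra.
Qed.

(** The bounds are the limits at 0 and at infinity, so the weight has total mass 1/r on the
    half-line. *)
Lemma tame_primitive_bounds (r t : R) :
  0 < r -> - / r < tame_primitive r t < 0.
Proof.
intros Hr; unfold tame_primitive.
assert (0 < Rpower t r) by apply exp_pos.
assert (0 < / (r * (1 + Rpower t r))) by (apply Rinv_0_lt_compat; nra).
assert (/ (r * (1 + Rpower t r)) < / r) by (apply Rinv_lt_contravar; nra).
lra.
Qed.

(** Since (1+y)^2 <= 2 + 2y^2 with y = t^r, it suffices to bound t^(jk) e^(-s) and t^(jk+2r) e^(-s),
    where s = t^k/p. The case j = 0 serves the integrand itself, and j = 2 the error made by
    replacing the exponential with a power. *)
Lemma tame_weight_dominates (j : nat) (r k p : R) :
  0 < r -> 0 < k -> 0 < p ->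
  exists M, 0 <= M /\
    forall t, 0 < t ->
      (Rpower t k / p) ^ j * exp (- (Rpower t k / p)) * Rpower t (r - 1)
      <= M * tame_weight r t.
Proof.
intros Hr Hk Hp.
assert (Hj : 0 <= INR j * k) by (pose proof (pos_INR j); nra).
destruct (Rpower_exp_bounded (INR j * k) k p) as [M1 [HM1 B1]]; try lra.
destruct (Rpower_exp_bounded (INR j * k + (r + r)) k p) as [M2 [HM2 B2]]; try lra.
assert (Hpj : 0 < / p ^ j) by now apply Rinv_0_lt_compat, pow_lt.
exists (/ p ^ j * (2 * M1 + 2 * M2)); split.
{ apply Rmult_le_pos; lra. }
intros t Ht; specialize (B1 t Ht); specialize (B2 t Ht).
rewrite !Rpower_plus in B2.
assert (E : Rpower t k ^ j = Rpower t (INR j * k)).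
{ rewrite <- Rpower_pow, Rpower_mult by apply exp_pos; f_equal; ring. }
unfold Rdiv at 1; rewrite Rpow_mult_distr, pow_inv, E.
set (e := exp _) in *; set (u := Rpower t (INR j * k)) in *.
unfold tame_weight; set (v := Rpower t (r - 1)); set (y := Rpower t r) in *.
assert (0 < e) by apply exp_pos; assert (0 < u) by apply exp_pos.
assert (0 < v) by apply exp_pos; assert (0 < y) by apply exp_pos.
assert (0 < (1 + y) ^ 2) by nra.
assert (H5 : u * e * (1 + y) ^ 2 <= 2 * M1 + 2 * M2).
{ assert (0 <= u * e * (1 - y) ^ 2)
    by (apply Rmult_le_pos; [nra | apply pow2_ge_0]).
  replace (u * e * (1 + y) ^ 2) with
    (2 * (u * e) + 2 * (u * (y * y) * e) - u * e * (1 - y) ^ 2) by ring.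
  lra. }
replace (u * / p ^ j * e * v) with
  (/ p ^ j * (u * e * (1 + y) ^ 2) * (v / (1 + y) ^ 2)) by
  (field; split; try apply pow_nonzero; lra).
apply Rmult_le_compat_r; [apply Rdiv_le_0_compat; lra|].
apply Rmult_le_compat_l; lra.
Qed.

(** * The primitive obtained by repeated integration by parts *)

(** Let F_m be a primitive of w^m t^(x-1) with w = 1 - t^k/q. Integrating by parts and writing t^k/q
    = 1 - w gives x F_m = w^m t^x + k m (F_(m-1) - F_m), which is solved for F_m. The parameter [q]
    stays independent of [m] so that induction on [m] is possible; both are specialised later, to q
    = n p and m = n. *)
Fixpoint euler_primitive (q k : R) (x : C) (m : nat) (t : R) : C :=
  match m with
  | O => (/ x * RCpower t x)%C
  | S m' =>
      (/ (x + RtoC (k * INR m)) *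
        (RtoC ((1 - Rpower t k / q) ^ m) * RCpower t x +
         RtoC (k * INR m) * euler_primitive q k x m' t))%C
  end.

Lemma Re_shift_pos (k : R) (x : C) (m : nat) :
  0 < k -> 0 < Re x -> 0 < Re (x + RtoC (k * INR m)).
Proof.
intros Hk Hx; pose proof (pos_INR m); simpl; unfold Re in *; nra.
Qed.

Lemma Re_pos_neq_0 (z : C) : 0 < Re z -> z <> RtoC 0.
Proof. intros Hz E; rewrite E in Hz; simpl in Hz; lra. Qed.

Lemma is_derive_euler_primitive (q k : R) (x : C) (m : nat) (t : R) :
  0 < q -> 0 < k -> 0 < Re x -> 0 < t ->
  is_derive (V := C_R_NormedModule) (euler_primitive q k x m) t
    (RtoC ((1 - Rpower t k / q) ^ m) * RCpower t (x - RtoC 1))%C.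
Proof.
intros Hq Hk Hx Ht.
assert (Hx0 := Re_pos_neq_0 _ Hx).
induction m as [|m IH].
- replace (RtoC ((1 - Rpower t k / q) ^ 0) * RCpower t (x - RtoC 1))%C
    with (/ x * (x * RCpower t (x - RtoC 1)))%C by (simpl; field; assumption).
  now apply is_derive_Cmult_l, is_derive_RCpower.
- assert (HK := Re_pos_neq_0 _ (Re_shift_pos k x (S m) Hk Hx)).
  set (K := k * INR (S m)) in *.
  assert (Hdu : is_derive (fun s => (1 - Rpower s k / q) ^ S m) t
    (INR (S m) * (0 - k * Rpower t (k - 1) / q) * (1 - Rpower t k / q) ^ m)).
  { apply (is_derive_pow (fun s => 1 - Rpower s k / q) (S m)).
    apply (is_derive_minus (V := R_NormedModule)).
    - apply (is_derive_const (V := R_NormedModule)).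
    - apply (is_derive_ext (fun s => / q * Rpower s k)).
      { intros s; apply Rmult_comm. }
      replace (k * Rpower t (k - 1) / q) with (/ q * (k * Rpower t (k - 1)))
        by (unfold Rdiv; ring).
      now apply is_derive_scal, is_derive_Rpower. }
  set (du := INR (S m) * _ * _) in Hdu.
  (* The spare factor t comes from t^x = t^(x-1) t. It turns t^(k-1) into t^k, so that the final
     identity involves t^k only through t^k/q. *)
  assert (Edu : du * t = - (K * (1 - Rpower t k / q) ^ m * (Rpower t k / q))).
  { rewrite <- (Rpower_minus1 k t) by assumption; unfold du, K; field_simplify_eq; [|lra].
    rewrite <- (Rpower_minus1 k t) by assumption; ring. }
  assert (D := is_derive_Cmult_l (/ (x + RtoC K)) _ t _
    (is_derive_plus (V := C_R_NormedModule) _ _ t _ _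
      (is_derive_RtoC_mult _ _ t _ _ Hdu (is_derive_RCpower x t Ht))
      (is_derive_Cmult_l (RtoC K) _ t _ IH))).
  refine (eq_ind _ (is_derive (V := C_R_NormedModule)
    (euler_primitive q k x (S m)) t) D _ _).
  cbv beta; change (@plus C_R_NormedModule) with Cplus.
  rewrite (RCpower_minus1 t x Ht).
  set (g := RCpower t (x - RtoC 1)); set (w := Rpower t k / q) in *.
  replace (RtoC du * (g * RtoC t))%C with (RtoC (du * t) * g)%C
    by (rewrite RtoC_mult; ring).
  rewrite Edu; simpl pow; rewrite RtoC_opp, !RtoC_mult, RtoC_minus.
  refine (_ : @eq C _ _); field; assumption.
Qed.

(** At this endpoint t^k = q, so the boundary term of every step m >= 1 vanishes and the recursion
    collapses to a product of the factors k m / (x + k m). These match the Pochhammer factors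
    because xp/k + jp = (p/k)(x + kj). *)
Lemma euler_primitive_end (p k : R) (x : C) (m n : nat) :
  0 < p -> 0 < k -> 0 < Re x -> (0 < n)%nat ->
  euler_primitive (INR n * p) k x m (Rpower (INR n * p) (/ k)) =
  (RtoC (1 / k) * (RtoC (INR (fact m)) * RtoC (p ^ (m + 1)) *
   RCpower (INR n * p) (x / RtoC k) / pk_pochhammer p k x (m + 1)))%C.
Proof.
intros Hp Hk Hx Hn.
assert (Hq : 0 < INR n * p) by (apply Rmult_lt_0_compat; [now apply lt_0_INR|assumption]).
assert (Hx0 := Re_pos_neq_0 _ Hx).
assert (Hk0 : RtoC k <> RtoC 0) by (intros E; apply RtoC_inj in E; lra).
assert (Hp0 : RtoC p <> RtoC 0) by (intros E; apply RtoC_inj in E; lra).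
assert (ET : Rpower (Rpower (INR n * p) (/ k)) k = INR n * p).
{ rewrite Rpower_mult, Rinv_l, Rpower_1; lra. }
assert (EC : RCpower (Rpower (INR n * p) (/ k)) x = RCpower (INR n * p) (x / RtoC k)).
{ unfold RCpower, Rpower; rewrite ln_exp, RtoC_mult, RtoC_inv by lra.
  f_equal; field; assumption. }
assert (Hshift : forall j, (x * RtoC p / RtoC k + RtoC (INR j * p) =
   RtoC p / RtoC k * (x + RtoC (k * INR j)))%C).
{ intros j; rewrite !RtoC_mult; field; assumption. }
assert (HK : forall j, (x + RtoC (k * INR j))%C <> RtoC 0).
{ intros j; now apply Re_pos_neq_0, Re_shift_pos. }
assert (Hpoch : forall j, pk_pochhammer p k x j <> RtoC 0).
{ induction j as [|j IH]; cbn [pk_pochhammer]; [apply C1_nz|].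
  rewrite Hshift; repeat apply Cmult_neq_0; auto.
  intros E; apply Hk0.
  apply (f_equal (fun z => z * RtoC k)%C) in E.
  rewrite Cmult_0_l, Cinv_l in E by assumption; now destruct C1_nz. }
rewrite RtoC_div, Nat.add_1_r by lra.
induction m as [|m IH].
- cbn [euler_primitive pk_pochhammer]; rewrite Hshift, EC.
  simpl fact; simpl pow; rewrite !Rmult_0_r, Rmult_1_r, Cplus_0_r.
  simpl INR; field; auto.
- change (pk_pochhammer p k x (S (S m))) with (pk_pochhammer p k x (S m) *
    (x * RtoC p / RtoC k + RtoC (INR (S m) * p)))%C.
  cbn [euler_primitive]; rewrite IH, ET, Hshift.
  unfold Rdiv at 1; rewrite Rinv_r, Rminus_diag, pow_i, EC by (lra || lia).
  rewrite fact_simpl, mult_INR, <- (tech_pow_Rmult p (S m)), !RtoC_mult.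
  specialize (HK (S m)); rewrite RtoC_mult in HK.
  field; auto.
Qed.

(** On this range 0 <= 1 - t^k/q <= 1, so each step of the recursion preserves a bound by a multiple
    of t^(Re x); in particular the primitive tends to 0 at 0. The constant may depend on [m] and
    [q], since the lower endpoint is chosen after them. *)
Lemma Cmod_euler_primitive_le (q k : R) (x : C) (m : nat) :
  0 < q -> 0 < k -> 0 < Re x ->
  exists M, 0 <= M /\ forall t, 0 < t -> Rpower t k <= q ->
    Cmod (euler_primitive q k x m t) <= M * Rpower t (Re x).
Proof.
intros Hq Hk Hx; induction m as [|m [M [HM IH]]].
- exists (Cmod (/ x)); split; [apply Cmod_ge_0|]; intros t _ _; simpl.
  rewrite Cmod_mult, Cmod_RCpower; lra.
- set (K := k * INR (S m)).
  assert (HK : 0 <= K) by (unfold K; pose proof (pos_INR (S m)); nra).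
  pose proof (Cmod_ge_0 (/ (x + RtoC K))) as HC.
  exists (Cmod (/ (x + RtoC K)) * (1 + K * M)); split.
  { apply Rmult_le_pos; [assumption|].
    pose proof (Rmult_le_pos _ _ HK HM); lra. }
  intros t Ht Htq; specialize (IH t Ht Htq).
  cbn [euler_primitive]; fold K; rewrite Cmod_mult, Rmult_assoc.
  apply Rmult_le_compat_l; [assumption|].
  eapply Rle_trans; [apply Cmod_triangle|].
  rewrite !Cmod_mult, Cmod_RCpower, !Cmod_R, (Rabs_pos_eq K) by assumption.
  assert (Hw : 0 <= 1 - Rpower t k / q <= 1).
  { assert (0 < Rpower t k / q) by (apply Rdiv_lt_0_compat; [apply exp_pos|assumption]).
    assert (Rpower t k / q <= 1); [|lra].
    apply (Rmult_le_reg_r q); [assumption|].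
    replace (Rpower t k / q * q) with (Rpower t k) by (field; lra); lra. }
  rewrite Rabs_pos_eq by (apply pow_le; lra).
  assert ((1 - Rpower t k / q) ^ S m <= 1).
  { rewrite <- (pow1 (S m)) at 2; apply pow_incr; lra. }
  assert (0 < Rpower t (Re x)) by apply exp_pos.
  rewrite Rmult_plus_distr_r, Rmult_assoc; apply Rplus_le_compat.
  + apply Rmult_le_compat_r; lra.
  + now apply Rmult_le_compat_l.
Qed.

(** * Integrals over compact intervals and their approximation *)

Definition pk_integrand (p k : R) (x : C) (t : R) : C :=
  (RtoC (exp (- (Rpower t k / p))) * RCpower t (x - RtoC 1))%C.

Lemma continuous_pk_integrand (p k : R) (x : C) (t : R) :
  0 < t -> continuous (U := C_R_NormedModule) (pk_integrand p k x) t.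
Proof.
intros Ht; apply continuous_RtoC_mult; [|now apply continuous_RCpower].
apply (continuous_comp (fun s => Rpower s k) (fun y => exp (- (y / p)))).
- now apply continuous_Rpower.
- apply (ex_derive_continuous (V := R_NormedModule)); auto_derive; exact I.
Qed.

Definition pk_integral (p k : R) (x : C) (a b : R) : C :=
  RInt (V := C_R_CompleteNormedModule) (pk_integrand p k x) a b.

Lemma ex_RInt_pk_integrand (p k : R) (x : C) (a b : R) :
  0 < a -> 0 < b -> ex_RInt (V := C_R_CompleteNormedModule) (pk_integrand p k x) a b.
Proof.
intros Ha Hb; apply (ex_RInt_continuous (V := C_R_CompleteNormedModule)).
intros t [Ht _]; apply continuous_pk_integrand.
eapply Rlt_le_trans; [|exact Ht]; now apply Rmin_glb_lt.
Qed.

Lemma is_RInt_pk_integral (p k : R) (x : C) (a b : R) :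
  0 < a -> 0 < b ->
  is_RInt (V := C_R_NormedModule) (pk_integrand p k x) a b (pk_integral p k x a b).
Proof.
intros Ha Hb; apply (RInt_correct (V := C_R_CompleteNormedModule)).
now apply ex_RInt_pk_integrand.
Qed.

Lemma Cmod_RInt_le_tame (f : R -> C) (r M a b : R) (l : C) :
  0 < r -> 0 < a <= b ->
  (forall t, a <= t <= b -> Cmod (f t) <= M * tame_weight r t) ->
  is_RInt (V := C_R_NormedModule) f a b l ->
  Cmod l <= M * (tame_primitive r b - tame_primitive r a).
Proof.
intros Hr Hab Hf Hl; rewrite <- C_norm.
apply (norm_RInt_le (V := C_R_NormedModule) f (fun t => M * tame_weight r t) a b);
  [lra | | exact Hl |].
- intros t Ht; rewrite C_norm; auto.
- apply (is_RInt_scal (V := R_NormedModule)).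
  now apply is_RInt_tame_weight.
Qed.

(** This controls both tails of the improper integral. The absolute value allows endpoints in either
    order, as the Cauchy criterion requires. *)
Lemma Cmod_pk_integral_le (p k : R) (x : C) :
  0 < p -> 0 < k -> 0 < Re x ->
  exists M, 0 <= M /\ forall a b, 0 < a -> 0 < b ->
    Cmod (pk_integral p k x a b) <=
    M * Rabs (tame_primitive (Re x) b - tame_primitive (Re x) a).
Proof.
intros Hp Hk Hx.
destruct (tame_weight_dominates 0 (Re x) k p Hx Hk Hp) as [M [HM B]].
exists M; split; [assumption|].
assert (W : forall a b, 0 < a <= b -> Cmod (pk_integral p k x a b) <=
    M * Rabs (tame_primitive (Re x) b - tame_primitive (Re x) a)).
{ intros a b Hab.
  eapply Rle_trans; [|apply Rmult_le_compat_l; [assumption|apply Rle_abs]].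
  apply (Cmod_RInt_le_tame (pk_integrand p k x)); auto.
  - intros t Ht; unfold pk_integrand.
    rewrite Cmod_mult, Cmod_RCpower, Cmod_R, Rabs_pos_eq by apply Rlt_le, exp_pos.
    specialize (B t); rewrite pow_O, Rmult_1_l in B.
    replace (Re (x - RtoC 1)%C) with (Re x - 1) by (simpl; unfold Re; ring).
    apply B; lra.
  - apply is_RInt_pk_integral; lra. }
intros a b Ha Hb; destruct (Rle_lt_dec a b) as [H|H]; [auto|].
unfold pk_integral.
rewrite <- (opp_RInt_swap (V := C_R_CompleteNormedModule))
  by now apply ex_RInt_pk_integrand.
rewrite Rabs_minus_sym.
eapply Rle_trans; [|apply W; lra].
right; exact (Cmod_opp (pk_integral p k x b a)).
Qed.

(** The integrands differ by at most s^2 e^(-s) t^(Re x - 1) / n in modulus, where s = t^k/p.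
    Domination with j = 2 and the total mass 1/Re x of the weight give a constant uniform in [n] and
    [a]. *)
Lemma pk_integral_sub_euler_primitive_le (p k : R) (x : C) :
  0 < p -> 0 < k -> 0 < Re x ->
  exists M, 0 <= M /\ forall n a, (0 < n)%nat ->
    let T := Rpower (INR n * p) (/ k) in
    0 < a <= T ->
    Cmod (pk_integral p k x a T -
      (euler_primitive (INR n * p) k x n T - euler_primitive (INR n * p) k x n a))
    <= M / INR n.
Proof.
intros Hp Hk Hx.
destruct (tame_weight_dominates 2 (Re x) k p Hx Hk Hp) as [M [HM B]].
exists (M / Re x); split; [now apply Rdiv_le_0_compat|].
intros n a Hn T Ha.
assert (HN : 0 < INR n) by now apply lt_0_INR.
assert (Hq : 0 < INR n * p) by now apply Rmult_lt_0_compat.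
assert (D : is_RInt (V := C_R_NormedModule)
  (fun t => RtoC ((1 - Rpower t k / (INR n * p)) ^ n) * RCpower t (x - RtoC 1))%C a T
  (euler_primitive (INR n * p) k x n T - euler_primitive (INR n * p) k x n a)%C).
{ apply (is_RInt_derive (V := C_R_CompleteNormedModule)
    (euler_primitive (INR n * p) k x n)); intros t; rewrite Rmin_left by lra; intros Ht.
  - apply is_derive_euler_primitive; lra || assumption.
  - apply continuous_RtoC_mult; [|apply continuous_RCpower; lra].
    apply (continuous_comp (fun s => Rpower s k) (fun y => (1 - y / (INR n * p)) ^ n)).
    + apply continuous_Rpower; lra.
    + apply (ex_derive_continuous (V := R_NormedModule)); auto_derive; exact I. }
assert (I1 := is_RInt_minus (V := C_R_NormedModule) _ _ _ _ _ _
  (is_RInt_pk_integral p k x a T ltac:(lra) ltac:(lra)) D).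
apply (Cmod_RInt_le_tame _ (Re x) (M / INR n)) in I1; [| assumption | assumption |].
- eapply Rle_trans; [exact I1|].
  replace (M / Re x / INR n) with (M / INR n * / Re x) by (field; lra).
  apply Rmult_le_compat_l; [now apply Rdiv_le_0_compat|].
  pose proof (tame_primitive_bounds (Re x) a Hx).
  pose proof (tame_primitive_bounds (Re x) T Hx); lra.
- intros t Ht.
  set (s := Rpower t k / p).
  replace (Rpower t k / (INR n * p)) with (s / INR n) by (unfold s; field; lra).
  unfold pk_integrand; fold s.
  set (g := RCpower t (x - RtoC 1)).
  replace (minus _ _) with (RtoC (exp (- s) - (1 - s / INR n) ^ n) * g)%C
    by (rewrite RtoC_minus; refine (_ : @eq C _ (_ - _))%C; ring).
  (* The condition t <= T is exactly s <= n, the range in which the exponential estimate holds. *)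
  assert (Hs : 0 <= s <= INR n).
  { split; [apply Rdiv_le_0_compat; [apply Rlt_le, exp_pos|assumption]|].
    apply (Rmult_le_reg_r p); [assumption|].
    replace (s * p) with (Rpower t k) by (unfold s; field; lra).
    replace (INR n * p) with (Rpower T k)
      by (unfold T; rewrite Rpower_mult, Rinv_l, Rpower_1; lra).
    apply Rle_Rpower_l; lra. }
  unfold g; rewrite Cmod_mult, Cmod_R, Cmod_RCpower.
  replace (Re (x - RtoC 1)%C) with (Re x - 1) by (simpl; unfold Re; ring).
  eapply Rle_trans.
  { apply Rmult_le_compat_r; [apply Rlt_le, exp_pos|].
    now apply exp_sub_pow_bound. }
  assert (Bt := B t ltac:(lra)); fold s in Bt.
  apply (Rmult_le_compat_r (/ INR n)) in Bt; [|now apply Rlt_le, Rinv_0_lt_compat].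
  unfold Rdiv; lra.
Qed.

(** * Convergence of the improper integral *)

Lemma at_right_Rpower_lt (r eps : R) :
  0 < r -> 0 < eps -> at_right 0 (fun t => 0 < t /\ Rpower t r < eps).
Proof.
intros Hr He.
exists (mkposreal (Rpower eps (/ r)) (exp_pos _)); intros t Ht H0; split; [assumption|].
apply Rabs_def2 in Ht; simpl in Ht; unfold minus, plus, opp in Ht; simpl in Ht.
replace eps with (Rpower (Rpower eps (/ r)) r)
  by (rewrite Rpower_mult, Rinv_l, Rpower_1; lra).
apply Rlt_Rpower_l; lra.
Qed.

Lemma p_infty_Rpower_gt (r M : R) :
  0 < r -> Rbar_locally p_infty (fun t => 0 < t /\ M < Rpower t r).
Proof.
intros Hr.
(* The maximum with 1 makes the base positive, so that taking the power 1/r and then r gives it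
   back. *)
set (B := Rmax M 1).
assert (HB : 0 < B) by (apply Rlt_le_trans with 1; [lra | apply Rmax_r]).
exists (Rpower B (/ r)); intros t Ht.
assert (H0 : 0 < Rpower B (/ r)) by apply exp_pos.
split; [lra|].
apply Rle_lt_trans with B; [apply Rmax_l|].
replace B with (Rpower (Rpower B (/ r)) r)
  by (rewrite Rpower_mult, Rinv_l, Rpower_1; lra).
apply Rlt_Rpower_l; lra.
Qed.

(** Changing the endpoints changes the integral by one piece near 0 and one near infinity. Both are
    small because [tame_primitive] has finite limits at the two ends. *)
Lemma pk_integral_cauchy (p k : R) (x : C) :
  0 < p -> 0 < k -> 0 < Re x ->
  exists L : C, filterlim (U := C) (fun ab => pk_integral p k x (fst ab) (snd ab))
    (filter_prod (at_right 0) (Rbar_locally p_infty)) (locally L).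
Proof.
intros Hp Hk Hx.
destruct (Cmod_pk_integral_le p k x Hp Hk Hx) as [M [HM B]].
apply (filterlim_locally_cauchy (U := C_R_CompleteNormedModule)); intros eps.
set (r := Re x) in *.
(* Each of the two pieces costs at most M eta; using M + 1 keeps the denominator positive and the
   final inequality strict. *)
set (eta := eps / (2 * (M + 1))).
assert (He : 0 < eta) by (apply Rdiv_lt_0_compat; [apply cond_pos|lra]).
assert (Hre : 0 < r * eta) by now apply Rmult_lt_0_compat.
(* With y = t^r, the primitive exceeds its limit -1/r by less than y/r, and lies below its limit 0
   by less than 1/(r y). Both are below eta under these thresholds. *)
exists (fun ab => (0 < fst ab /\ Rpower (fst ab) r < r * eta) /\
                  (0 < snd ab /\ / (r * eta) < Rpower (snd ab) r)); split.
{ eexists; [apply (at_right_Rpower_lt r (r * eta)); assumption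
           |apply (p_infty_Rpower_gt r (/ (r * eta))); assumption|].
  now intros a b. }
intros [a b] [a' b']; simpl; intros [[Ha1 Ha2] [Hb1 Hb2]] [[Ha1' Ha2'] [Hb1' Hb2']].
assert (E0 : forall t, Rpower t r < r * eta -> - / r < tame_primitive r t < - / r + eta).
{ intros t Ht; split; [now apply tame_primitive_bounds|].
  unfold tame_primitive; assert (0 < Rpower t r) by apply exp_pos.
  set (y := Rpower t r) in *.
  assert (/ r - / (r * (1 + y)) < eta); [|lra].
  replace (/ r - / (r * (1 + y))) with (y / r * / (1 + y)) by (field; lra).
  assert (/ (1 + y) < 1) by (rewrite <- Rinv_1; apply Rinv_lt_contravar; lra).
  assert (0 < / (1 + y)) by (apply Rinv_0_lt_compat; lra).
  assert (y / r < eta).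
  { apply (Rmult_lt_reg_l r); [assumption|].
    replace (r * (y / r)) with y by (field; lra); assumption. }
  assert (0 < y / r) by now apply Rdiv_lt_0_compat.
  nra. }
assert (E1 : forall t, / (r * eta) < Rpower t r -> - eta < tame_primitive r t < 0).
{ intros t Ht; split; [|now apply tame_primitive_bounds].
  unfold tame_primitive; assert (0 < Rpower t r) by apply exp_pos.
  set (y := Rpower t r) in *.
  assert (/ (r * (1 + y)) < eta); [|lra].
  assert (0 < / (r * eta)) by now apply Rinv_0_lt_compat.
  apply Rlt_le_trans with (/ (r * / (r * eta))).
  - apply Rinv_lt_contravar; [|nra]. apply Rmult_lt_0_compat; nra.
  - right; field; lra. }
apply (norm_compat1 (V := C_R_NormedModule)); rewrite C_norm.
assert (Chas : forall u v w, 0 < u -> 0 < v -> 0 < w ->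
  (pk_integral p k x u v + pk_integral p k x v w)%C = pk_integral p k x u w).
{ intros u v w Hu Hv Hw.
  apply (RInt_Chasles (V := C_R_CompleteNormedModule)); now apply ex_RInt_pk_integrand. }
replace (minus _ _) with (pk_integral p k x a' a + pk_integral p k x b b')%C.
2:{ rewrite <- (Chas a' a b'), <- (Chas a b b') by assumption.
    refine (_ : @eq C _ (_ - _))%C; ring. }
eapply Rle_lt_trans; [apply Cmod_triangle|].
pose proof (B a' a Ha1' Ha1) as Ba; pose proof (B b b' Hb1 Hb1') as Bb.
pose proof (E0 a Ha2); pose proof (E0 a' Ha2').
pose proof (E1 b Hb2); pose proof (E1 b' Hb2').
assert (Rabs (tame_primitive r a - tame_primitive r a') < eta) by (apply Rabs_def1; lra).
assert (Rabs (tame_primitive r b' - tame_primitive r b) < eta) by (apply Rabs_def1; lra).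
assert (Ee : pos eps = 2 * (M + 1) * eta) by (unfold eta; field; lra).
rewrite Ee; nra.
Qed.

(** * Identification of the limit with the integral *)

Theorem theorem2p4 (k p : R) (x : C)
  (hk : 0 < k) (hp : 0 < p)
  (hx : forall m : Z, (m < 0)%Z -> x <> RtoC (k * IZR m))
  (hre : 0 < Re x) :
  ex_Clim_seq (pkGamma_seq p k x) /\
  is_RInt_gen (V := C_R_NormedModule)
    (fun t : R =>
       (RtoC (exp (- (Rpower t k / p))) * RCpower t (x - RtoC 1))%C)
    (at_right 0) (Rbar_locally p_infty)
    (pkGamma p k x).
Proof.
destruct (pk_integral_cauchy p k x hp hk hre) as [L HL].
destruct (pk_integral_sub_euler_primitive_le p k x hp hk hre) as [M [HM BM]].
assert (Hk0 : RtoC k <> RtoC 0) by (intros E; apply RtoC_inj in E; lra).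
assert (Hlim : filterlim (fun n => (RtoC (1 / k) * pkGamma_seq p k x n)%C)
  eventually (locally (T := C_R_NormedModule) L)).
{ apply (filterlim_locally_ball_norm (U := C_R_NormedModule)); intros eps.
  assert (He : 0 < eps / 3) by (apply Rdiv_lt_0_compat; [apply cond_pos|lra]).
  (* The product filter gives separate conditions on the two endpoints, so T, hence n, can be fixed
     before the lower endpoint a. *)
  destruct (proj1 (filterlim_locally_ball_norm (U := C_R_NormedModule) _ _) HL
    (mkposreal _ He)) as [Q S HQ HS HQS].
  assert (Ev1 : eventually (fun n => (0 < n)%nat)) by (exists 1%nat; auto).
  assert (HI : forall B, eventually (fun n => B < INR n)).
  { intros B; exact (is_lim_seq_INR (fun y => B < y) (ex_intro _ B (fun y Hy => Hy))). }
  assert (Ev2 : eventually (fun n => S (Rpower (INR n * p) (/ k)))).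
  { destruct HS as [B HB].
    destruct (p_infty_Rpower_gt (/ k) B) as [B' HB']; [now apply Rinv_0_lt_compat|].
    generalize (HI (B' / p)); apply filter_imp; intros n Hn.
    apply HB, HB'; apply (Rmult_lt_compat_r p) in Hn; [|assumption].
    replace (B' / p * p) with B' in Hn by (field; lra); exact Hn. }
  generalize (filter_and _ _ Ev1 (filter_and _ _ Ev2 (HI (M / (eps / 3))))).
  apply filter_imp; intros n (Hn & HSn & HMn).
  assert (HN : 0 < INR n) by now apply lt_0_INR.
  assert (Hq : 0 < INR n * p) by now apply Rmult_lt_0_compat.
  set (T := Rpower (INR n * p) (/ k)) in *.
  destruct (Cmod_euler_primitive_le (INR n * p) k x n Hq hk hre) as [K [HK BK]].
  assert (Hsm : 0 < eps / 3 / (K + 1)) by (apply Rdiv_lt_0_compat; lra).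
  (* The point [a] is chosen after [n] and [K]: it lies in [Q], makes K a^(Re x) less than eps/3,
     and satisfies a^k < n p, which places it below T. *)
  destruct (filter_ex _ (filter_and _ _ HQ (filter_and _ _
    (at_right_Rpower_lt (Re x) _ hre Hsm)
    (at_right_Rpower_lt k _ hk Hq)))) as [a (HQa & [Ha Ha1] & [_ Ha2])].
  assert (HaT : a <= T).
  { apply Rnot_lt_le; intros Hlt.
    assert (Rpower T k < Rpower a k) by
      (apply Rlt_Rpower_l; [assumption | split; [apply exp_pos|assumption]]).
    assert (Rpower T k = INR n * p) by (unfold T; rewrite Rpower_mult, Rinv_l, Rpower_1; lra).
    lra. }
  unfold pkGamma_seq, ball_norm; rewrite C_norm.
  rewrite <- euler_primitive_end by assumption; fold T.
  specialize (HQS a T HQa HSn); unfold ball_norm in HQS; rewrite C_norm in HQS;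
    simpl in HQS.
  specialize (BM n a Hn (conj Ha HaT)); fold T in BM.
  specialize (BK a Ha (Rlt_le _ _ Ha2)).
  set (J := pk_integral p k x a T) in *.
  set (ET := euler_primitive (INR n * p) k x n T) in *.
  set (Ea := euler_primitive (INR n * p) k x n a) in *.
  change (Cmod (ET - L) < eps).
  (* The three errors are the tails of the integral, the replacement of the exponential, and the
     primitive at the lower endpoint. *)
  replace (ET - L)%C with ((J - L) + (- (J - (ET - Ea)) + Ea))%C by ring.
  assert (Cmod Ea < eps / 3).
  { eapply Rle_lt_trans; [exact BK|].
    assert (0 < Rpower a (Re x)) by apply exp_pos.
    assert (eps / 3 = (K + 1) * (eps / 3 / (K + 1))) by (field; lra).
    nra. }
  assert (M / INR n < eps / 3).
  { apply (Rmult_lt_reg_r (INR n)); [assumption|].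
    apply (Rmult_lt_compat_r (eps / 3)) in HMn; [|assumption].
    replace (M / INR n * INR n) with M by (field; lra).
    replace (M / (eps / 3) * (eps / 3)) with M in HMn by (field; lra).
    lra. }
  eapply Rle_lt_trans; [apply Cmod_triangle|].
  pose proof (Cmod_triangle (- (J - (ET - Ea))) Ea) as Htr; rewrite Cmod_opp in Htr.
  change (Cmod (J - L) < eps / 3) in HQS.
  lra. }
assert (Hseq : filterlim (pkGamma_seq p k x) eventually (locally (RtoC k * L)%C)).
{ apply (filterlim_ext (fun n => RtoC k * (RtoC (1 / k) * pkGamma_seq p k x n))%C).
  { intros n; rewrite RtoC_div by lra; field; assumption. }
  exact (filterlim_comp_2 (fun _ => RtoC k) _ Cmult (filterlim_const (RtoC k)) Hlim
    (filterlim_Cmult (RtoC k) L)). }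
assert (Hex : ex_Clim_seq (pkGamma_seq p k x)) by now exists (RtoC k * L)%C.
split; [exact Hex|].
(* The value of [Clim_seq] is specified only for a convergent sequence, so [Hex] is needed before
   uniqueness of limits can identify it. *)
assert (EL : pkGamma p k x = L).
{ unfold pkGamma.
  rewrite (filterlim_locally_unique (V := C_R_NormedModule) (pkGamma_seq p k x)
    (Clim_seq (pkGamma_seq p k x)) (RtoC k * L)%C (filterlim_Clim_seq _ Hex) Hseq).
  rewrite RtoC_div by lra; field; assumption. }
rewrite EL; intros P HP.
(* The generalised integral asks for an actual integral on each interval, not only for the value of
   the total [RInt]; positive endpoints ensure that it exists. *)
assert (Hpos : filter_prod (at_right 0) (Rbar_locally p_infty)
  (fun ab : R * R => 0 < fst ab /\ 0 < snd ab)).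
{ eexists; [apply (at_right_Rpower_lt 1 1) | apply (p_infty_Rpower_gt 1 1) |];
    [lra | lra | lra |].
  intros a b [Ha _] [Hb _]; now split. }
assert (HLP : filter_prod (at_right 0) (Rbar_locally p_infty)
  (fun ab : R * R => P (pk_integral p k x (fst ab) (snd ab)))) by exact (HL P HP).
generalize (filter_and _ _ HLP Hpos); unfold filtermapi; apply filter_imp.
intros [a b] [HPab [Ha Hb]].
exists (pk_integral p k x a b); split; [|exact HPab].
now apply is_RInt_pk_integral.
Qed.
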